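(* Let $k\ge1$, $d\ge0$. Let $\mathcal S_k$ be the set of vectors $p=(p_\epsilon)_{\epsilon\in\{0,1\}^k}$ of nonnegative integers with $\sum_\epsilon(1-2\epsilon_i)p_\epsilon=0$ for each $i=1,\dots,k$, and let $m_d(k)$ be the number of $p\in\mathcal S_k$ with $\sum_\epsilon p_\epsilon=2d$. Let $\mathcal F_d$ be the collection of $d$-element subsets of $\Omega_{2d}=\{1,2,\dots,2d\}$, and let the symmetric group $S_{2d}$ act on $\mathcal F_d^k=\mathcal F_d\times\cdots\times\mathcal F_d$ ($k$ factors) diagonally, via $\sigma(A_1,\dots,A_k)=(\sigma A_1,\dots,\sigma A_k)$ with $\sigma A=\{\sigma(a):a\in A\}$. Then $m_d(k)$ equals the number of orbits of this action of $S_{2d}$ on $\mathcal F_d^k$. *)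

(* Defs.v *)
From HB Require Import structures.
From mathcomp Require Import all_boot all_order all_algebra all_fingroup.
From mathcomp Require Import finmap.
From mathcomp Require Import boolp classical_sets functions cardinality.

Set Implicit Arguments.
Unset Strict Implicit.
Unset Printing Implicit Defensive.

Import GRing.Theory.

Definition cube (k : nat) := {ffun 'I_k -> bool}.

Definition inS (k : nat) (p : {ffun cube k -> nat}) : Prop :=
  forall i : 'I_k,
    (\sum_(eps : cube k) (1 - 2 * (eps i : nat)%:Z) * (p eps)%:Z = 0 :> int)%R.

Definition Sdeg (k d : nat) : set {ffun cube k -> nat} :=
  [set p | inS p /\ \sum_(eps : cube k) p eps = 2 * d]%classic.

(* [fset_set] returns the empty set on infinite sets, so the next fact is what
   makes [m] below a genuine count. *)
Lemma finite_Sdeg (k d : nat) : finite_set (@Sdeg k d).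
Proof.
pose g (q : {ffun cube k -> 'I_(2 * d).+1}) : {ffun cube k -> nat} :=
  [ffun e => nat_of_ord (q e)].
apply: (@sub_finite_set _ _ (range g)); last exact/finite_image/finite_finset.
move=> p [_ psum]; have ple e : p e < (2 * d).+1.
  by rewrite ltnS -psum (bigD1 e) //= leq_addr.
by exists [ffun e => Ordinal (ple e)] => //; apply/ffunP => e; rewrite !ffunE.
Qed.

Definition m (d k : nat) : nat := #|` fset_set (@Sdeg k d)|%fset.

(* The ground set {1, ..., 2d} is rendered as 'I_(2 * d) = {0, ..., 2d - 1}. *)
Definition Fd (d : nat) : {set {set 'I_(2 * d)}} :=
  [set A : {set 'I_(2 * d)} | #|A| == d].

Definition Fdk (d k : nat) : {set {ffun 'I_k -> {set 'I_(2 * d)}}} :=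
  [set A : {ffun 'I_k -> {set 'I_(2 * d)}} | [forall i, A i \in Fd d]].

Section DiagonalAction.
Variables (n k : nat).

Definition diag_act (A : {ffun 'I_k -> {set 'I_n}}) (s : 'S_n) :
    {ffun 'I_k -> {set 'I_n}} :=
  [ffun i => [set s a | a in A i]].

Fact diag_act1 : diag_act^~ 1%g =1 id.
Proof.
move=> A; apply/ffunP => i; rewrite ffunE -[RHS]imset_id.
by apply: eq_imset => a; rewrite perm1.
Qed.

(* In MathComp (s * t) a = t (s a), so this is a right action; its orbits are
   those of the left action sigma . A. *)
Fact diag_actM A : act_morph diag_act A.
Proof.
move=> s t; apply/ffunP => i; rewrite !ffunE -imset_comp.
by apply: eq_imset => a; rewrite /= permM.
Qed.

Canonical diag_action := TotalAction diag_act1 diag_actM.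

End DiagonalAction.

Lemma acts_Fdk (d k : nat) :
  [acts [set: 'S_(2 * d)], on Fdk d k | diag_action (2 * d) k].
Proof.
apply/actsP => s _ A; rewrite !inE.
by apply: eq_forallb => i; rewrite !inE ffunE card_imset //; apply: perm_inj.
Qed.

Definition diag_orbits (d k : nat) :
    {set {set {ffun 'I_k -> {set 'I_(2 * d)}}}} :=
  [set orbit (diag_action (2 * d) k) [set: 'S_(2 * d)] A | A in Fdk d k].

(* Main.v *)
(* The orbit of (A_1, ..., A_k) is determined by the sizes p_eps of the atoms
   { a | forall i, a \in A_i <-> eps_i = 1 } of the Venn diagram: the A_i are
   recovered from the word listing the atom of each point, and two words are
   permutations of one another as soon as every letter occurs equally often in
   both. Any p with sum_eps p_eps = 2d comes from some word, and then
   sum_eps (1 - 2 eps_i) p_eps = 2d - 2 |A_i|, so p lies in S_k exactly when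
   all |A_i| = d. *)
Require Import Defs.
From mathcomp Require Import all_boot all_order all_algebra all_fingroup.
From mathcomp Require Import finmap zify.
From mathcomp Require Import classical_sets cardinality.

Set Implicit Arguments.
Unset Strict Implicit.
Unset Printing Implicit Defensive.

Section AtomProfile.
Variables (n k : nat).
Implicit Types (A B : {ffun 'I_k -> {set 'I_n}}) (s : 'S_n).

(** The label of the Venn cell containing [a]; thus [mktuple (atom A)] is the word that encodes
    [A]. *)
Definition atom A (a : 'I_n) : cube k := [ffun i => a \in A i].

Definition profile A : {ffun cube k -> nat} :=
  [ffun eps => #|[set a | atom A a == eps]|].

Lemma atom_inj A B : atom A =1 atom B -> A = B.
Proof.
move=> eqAB; apply/ffunP => i; apply/setP => a.
by move/ffunP/(_ i): (eqAB a); rewrite !ffunE.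
Qed.

Lemma atom_diag_act A s a : atom (diag_act A s) (s a) = atom A a.
Proof.
by apply/ffunP => i; rewrite !ffunE mem_imset //; apply: perm_inj.
Qed.

(** [s] maps each atom of [A] bijectively onto the atom of [diag_act A s] with the same label. *)
Lemma profile_diag_act A s : profile (diag_act A s) = profile A.
Proof.
apply/ffunP => eps; rewrite !ffunE -[RHS](card_imset _ (@perm_inj _ s)).
apply: eq_card => b; rewrite -(permKV s b) mem_imset; last exact: perm_inj.
by rewrite !inE atom_diag_act.
Qed.

Lemma count_atom A eps :
  count_mem eps (mktuple (atom A)) = profile A eps.
Proof.
rewrite /= count_map ffunE cardsE cardE [X in size X]/enum_mem size_filter.
by rewrite enumT.
Qed.

Lemma profile_eq_orbit A B :
  profile A = profile B -> exists s, B = diag_act A s.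
Proof.
move=> eqAB.
have: perm_eq (mktuple (atom B)) (mktuple (atom A)).
  by apply/allP => eps _; apply/eqP; rewrite !count_atom eqAB.
(* Here [atom B a = atom A (s a)]: [s] sends points of [B] to points of [A], hence the inverse as
   witness. *)
case/tuple_permP => s /val_inj eq_st; exists s^-1%g; apply: atom_inj => a.
rewrite -[in RHS](permK s a) atom_diag_act.
by move: (congr1 (fun t => tnth t a) eq_st); rewrite !tnth_mktuple.
Qed.

Lemma sum_profile A : \sum_eps profile A eps = n.
Proof.
rewrite -[RHS]card_ord -sum1_card (partition_big (atom A) xpredT) //=.
by apply: eq_bigr => eps _; rewrite ffunE cardsE -sum1_card.
Qed.

(** The atoms whose label has [eps i] true partition [A i]. *)
Lemma sum_profile_mem A i : \sum_(eps : cube k | eps i) profile A eps = #|A i|.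
Proof.
rewrite -sum1_card (partition_big (atom A) (fun eps : cube k => eps i)) /=.
  apply: eq_bigr => eps epsi; rewrite ffunE -sum1dep_card.
  apply: eq_bigl => a; rewrite andbC; case: eqP => //= atomE.
  by move: epsi; rewrite -atomE ffunE => ->.
by move=> a; rewrite ffunE.
Qed.

Lemma profile_surj (p : {ffun cube k -> nat}) :
  \sum_eps p eps = n -> exists A, profile A = p.
Proof.
move=> psum; pose w := flatten [seq nseq (p eps) eps | eps <- enum (cube k)].
have szw : size w == n.
  rewrite size_flatten /shape -map_comp sumnE big_map enumT -psum.
  by apply/eqP/eq_bigr => eps _; rewrite /= size_nseq.
pose t : n.-tuple (cube k) := Tuple szw.
(* [A i] collects the positions whose letter has bit [i] set, which makes [t] the word of [A]. *)
exists [ffun i => [set a | tnth t a i]]; apply/ffunP => eps.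
rewrite -count_atom.
have -> : [tuple atom [ffun i => [set a | tnth t a i]] a | a < n] = t.
  apply: eq_from_tnth => a; rewrite tnth_mktuple.
  by apply/ffunP => i; rewrite !ffunE inE.
(* Only the block of copies of [eps] contributes to the count. *)
rewrite /= count_flatten -map_comp sumnE big_map enumT (bigD1 eps) //=.
rewrite count_nseq /= eqxx mul1n big1 ?addn0 // => e /negPf e_neq.
by rewrite count_nseq /= e_neq.
Qed.

End AtomProfile.

Lemma profile_inS d k (A : {ffun 'I_k -> {set 'I_(2 * d)}}) :
  inS (profile A) <-> A \in Fdk d k.
Proof.
have signed i : (\sum_(eps : cube k) (1 - 2 * (eps i : nat)%:Z) * (profile A eps)%:Z
    = (2 * d)%:Z - (2 * #|A i|)%:Z :> int)%R.
  have Posz_sum (P : pred (cube k)) (F : cube k -> nat) :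
      ((\sum_(eps | P eps) F eps)%N%:Z = \sum_(eps | P eps) (F eps)%:Z)%R.
    exact: (big_morph Posz PoszD (erefl _)).
  (* Both terms on the right become sums of atom sizes, to be compared label by label. *)
  rewrite -sum_profile_mem big_distrr /= -[X in (X%:Z - _)%R](sum_profile A).
  rewrite !Posz_sum [X in (_ - X)%R]big_mkcond -GRing.sumrB.
  by apply: eq_bigr => eps _; case: (eps i); lia.
rewrite inE; split=> [S_A | /forallP cardA i].
  by apply/forallP => i; move: (S_A i); rewrite signed inE; lia.
by move: (cardA i); rewrite signed inE; lia.
Qed.

Theorem theorem3p1 (k d : nat) (k_ge1 : (1 <= k)%N) :
  m d k = #|diag_orbits d k|.
Proof.
pose to := diag_action (2 * d) k; pose G := [set: 'S_(2 * d)].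
(* The profile of an arbitrary representative; the default is never reached on an orbit, which is
   nonempty. *)
pose h (O : {set {ffun 'I_k -> {set 'I_(2 * d)}}}) :=
  profile (odflt [ffun=> finset.set0] [pick A in O]).
have hE A : h (orbit to G A) = profile A.
  rewrite /h; case: pickP => [B /orbitP[s _ <-] | /(_ A)].
    exact: profile_diag_act.
  by rewrite orbit_refl.
have h_inj : {in diag_orbits d k &, injective h}.
  move=> _ _ /finset.imsetP[A _ ->] /finset.imsetP[B _ ->]; rewrite !hE.
  move=> /profile_eq_orbit[s ->]; apply/esym/orbit_eqP.
  by apply/orbitP; exists s.
(* The image of [h] is exactly [Sdeg k d], so injectivity of [h] finishes the count. *)
have -> : m d k = #|` [fset h O | O in diag_orbits d k]|%fset.
  congr (#|` _|)%fset; apply/fsetP => p.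
  rewrite in_fset_set; last exact: finite_Sdeg.
  apply/idP/imfsetP => [|[_ /finset.imsetP[A FA ->] ->]]; last first.
    by rewrite inE hE; split; [apply/profile_inS | apply: sum_profile].
  rewrite inE => -[Sp psum]; have [A defp] := profile_surj psum.
  exists (orbit to G A); last by rewrite hE.
  by apply: imset_f; apply/profile_inS; rewrite defp.
by rewrite card_in_imfset //= cardE.
Qed.
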